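(* Let $I\subset S$ be a nonzero proper graded ideal and let $\mathfrak{p}\in\operatorname{Ass}^\infty(I)$. Then: (a) for all $k\ge1$ with $\mathfrak{p}\in\operatorname{Ass}(I^k)$, $\alpha((I^k:\mathfrak{p})/I^k)\le \mathrm{v}_\mathfrak{p}(I^k)\le \omega((I^k:\mathfrak{p})/I^k)$; (b) the functions $k\mapsto\alpha((I^k:\mathfrak{p})/I^k)$ and $k\mapsto\omega((I^k:\mathfrak{p})/I^k)$ are linear functions of $k$ (with integer coefficients) for $k\gg0$; (c) there exist functions $f(k),g(k)$ which are linear in $k$ for $k\gg0$ such that $f(k)\le \mathrm{v}(I^k)\le g(k)$ for all $k\gg0$.
   Context: $S=K[x_1,\dots,x_n]$ is a standard graded polynomial ring over a field $K$, $S_d$ its degree-$d$ component, $\mathfrak{m}=(x_1,\dots,x_n)$. For a graded ideal $I\subset S$ and $\mathfrak{p}\in\operatorname{Ass}(I)$, $\mathrm{v}_\mathfrak{p}(I)=\min\{d:\exists f\in S_d \text{ with } (I:f)=\mathfrak{p}\}$ and $\mathrm{v}(I)=\min\{d:\exists f\in S_d\text{ with }(I:f)\in\operatorname{Ass}(I)\}$. $\operatorname{Ass}^\infty(I)$ is the set of primes lying in $\operatorname{Ass}(I^k)$ for all $k\gg0$ (stable primes; $\operatorname{Ass}(I^k)$ is eventually constant by Brodmann). For a nonzero finitely generated graded $S$-module $M$, $\alpha(M)=\min\{d:M_d\ne0\}$ and $\omega(M)=\max\{d:(M/\mathfrak{m}M)_d\neq0\}$ (the largest degree of a minimal homogeneous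 generator). *)

(* Defs.v *)
From HB Require Import structures.
From mathcomp Require Import all_boot all_order all_algebra.
From mathcomp Require Import mpoly.
Set Implicit Arguments. Unset Strict Implicit. Unset Printing Implicit Defensive.
Import Order.TTheory GRing.Theory Num.Theory.
Local Open Scope ring_scope.

Section Graded.
Variables (K : fieldType) (n : nat).
Local Notation S := {mpoly K[n]}.

(* subsets of S (ideals are represented by their membership predicate) *)
Definition subS := S -> Prop.

(* f is homogeneous of degree d, i.e. f \in S_d (0 lies in every S_d) *)
Definition is_homog (d : nat) (f : S) : Prop := f \is ishomog1 d mdeg.

Definition gen_ideal (G : subS) : subS :=
  fun f => exists s : seq (S * S),
    (forall q, q \in s -> G q.2) /\ f = \sum_(q <- s) q.1 * q.2.

Definition is_gideal (I : subS) : Prop :=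
  [/\ I 0, (forall a b, I a -> I b -> I (a + b)) & (forall r a, I a -> I (r * a))].

Definition graded_ideal (I : subS) : Prop :=
  exists G : subS, (forall g, G g -> exists d, is_homog d g) /\
                   (forall f, I f <-> gen_ideal G f).

Definition nonzero_gideal (I : subS) : Prop := exists f, I f /\ f != 0.
Definition proper_gideal (I : subS) : Prop := ~ I 1.

Definition ideal_mul (I J : subS) : subS :=
  gen_ideal (fun h => exists a b, I a /\ J b /\ h = a * b).
Fixpoint ideal_pow (I : subS) (k : nat) : subS :=
  match k with
  | 0 => gen_ideal (fun g => g = 1)
  | k'.+1 => ideal_mul (ideal_pow I k') I
  end.
Definition ideal_add (I J : subS) : subS := gen_ideal (fun h => I h \/ J h).

Definition max_ideal : subS := gen_ideal (fun g => exists i : 'I_n, g = 'X_i).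

Definition colon_elt (I : subS) (f : S) : subS := fun g => I (g * f).
Definition colon (I J : subS) : subS := fun g => forall h, J h -> I (g * h).

Definition same_set (A B : subS) : Prop := forall g, A g <-> B g.

Definition prime_gideal (P : subS) : Prop :=
  [/\ is_gideal P, ~ P 1 & forall a b, P (a * b) -> P a \/ P b].

Definition Ass (I : subS) (P : subS) : Prop :=
  prime_gideal P /\ exists f, same_set (colon_elt I f) P.

Definition Ass_infty (I : subS) (P : subS) : Prop :=
  exists k0, forall k, (k0 <= k)%N -> Ass (ideal_pow I k) P.

Definition vP_is (I P : subS) (d : nat) : Prop :=
  (exists f, is_homog d f /\ same_set (colon_elt I f) P) /\
  (forall d' f, is_homog d' f -> same_set (colon_elt I f) P -> (d <= d')%N).

Definition v_is (I : subS) (d : nat) : Prop :=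
  (exists f, is_homog d f /\ exists P, Ass I P /\ same_set (colon_elt I f) P) /\
  (forall d' f, is_homog d' f -> (exists P, Ass I P /\ same_set (colon_elt I f) P) ->
     (d <= d')%N).

(* For graded ideals I \subseteq J and the graded module M = J/I:
   alpha(M) = d : least degree d with M_d <> 0, i.e. some homogeneous
   f of degree d lies in J but not in I. *)
Definition alpha_is (J I : subS) (d : nat) : Prop :=
  (exists f, is_homog d f /\ J f /\ ~ I f) /\
  (forall d' f, is_homog d' f -> J f -> ~ I f -> (d <= d')%N).

(* omega(M) = d : largest d with (M/mM)_d <> 0.  Here M/mM = J/(mJ + I),
   so (M/mM)_d <> 0 iff some homogeneous f of degree d lies in J but
   not in mJ + I. *)
Definition omega_is (J I : subS) (d : nat) : Prop :=
  let N := ideal_add (ideal_mul max_ideal J) I in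
  (exists f, is_homog d f /\ J f /\ ~ N f) /\
  (forall d' f, is_homog d' f -> J f -> ~ N f -> (d' <= d)%N).

End Graded.

(* Main.v *)
Require Import Defs.
From Stdlib Require Import Classical.
From HB Require Import structures.
From mathcomp Require Import all_boot all_order all_algebra.
From mathcomp Require Import mpoly zify ring.
Set Implicit Arguments. Unset Strict Implicit. Unset Printing Implicit Defensive.
Import Order.TTheory GRing.Theory Num.Theory.
Local Open Scope ring_scope.

(**
Write [J_k = (I^k : P)] and [N_k = m J_k + I^k].  Choose homogeneous generators [f_i] of [I]
and a nonzero homogeneous [b] in [I], and map [K[x, y]] onto the Rees algebra by [y_i |-> f_i t].
As [b J_k] lies in [I^k], the sums of the [b J_k] and of the [b N_k] pull back to bihomogeneous
ideals of [K[x, y]], and the degrees of the minimal generators of [J_k / I^k] are read off, up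
to the shift [deg b], from the monomials [u] leading for the first ideal but not for the second.
By Dickson's lemma, whether [u] is such a monomial depends only on its exponents truncated at
some [c].  So for large [k] the extremal degrees are the extrema of finitely many linear
functions, hence are linear; by Nakayama [alpha] is the least degree of a minimal generator.

For [v_P <= omega]: if every minimal generator had degree below [v_P], each would be killed
modulo [I^k] by an element outside [P], hence so would all of [J_k], which is absurd for a
witness of [P].  In (c), [0 <= v <= v_P <= omega] suffices.
*)

(** * Extrema of sets of naturals and of finite families of affine functions *)

Lemma ex_least (P : nat -> Prop) :
  (exists k, P k) -> exists k, P k /\ forall j, P j -> (k <= j)%N.
Proof.
case=> k; elim/ltn_ind: k => k IH Pk.
case: (classic (exists2 j, (j < k)%N & P j)) => [[j ltjk Pj]|none].
  exact: IH ltjk Pj.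
by exists k; split=> // j Pj; rewrite leqNgt; apply/negP => lt; apply: none; exists j.
Qed.

Lemma ex_greatest (P : nat -> Prop) (B : nat) :
  (exists k, P k) -> (forall k, P k -> (k <= B)%N) ->
  exists k, P k /\ forall j, P j -> (j <= k)%N.
Proof.
move=> [k0 Pk0] leB.
have [|j [[k Pk ->] minj]] := @ex_least (fun j => exists2 k, P k & j = (B - k)%N).
  by exists (B - k0)%N, k0.
exists k; split=> // i Pi; have := minj (B - i)%N (ex_intro2 _ _ i Pi erefl).
by have := leB _ Pi; have := leB _ Pk; lia.
Qed.

(** The winner is the lexicographic maximum of slope and intercept. Distinct integer slopes differ
    by at least 1, so the larger one prevails once [k] exceeds the gap between the intercepts. *)
Lemma eventually_max (T : eqType) (s : seq T) (Q : T -> Prop) (a b : T -> int) :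
  (exists2 x, x \in s & Q x) ->
  exists x0, [/\ x0 \in s, Q x0 & exists k0 : nat, forall k : nat, (k0 <= k)%N ->
    forall x, x \in s -> Q x -> a x * k%:Z + b x <= a x0 * k%:Z + b x0].
Proof.
elim: s => [[x]//|y s IH] [x xs Qx].
case: (classic (exists2 x, x \in s & Q x)) => [/IH [x0 [x0s Qx0 [k0 maxx0]]]|none].
  have x0ys : x0 \in y :: s by rewrite inE x0s orbT.
  case: (classic (Q y)) => Qy; last first.
    exists x0; split=> //; exists k0 => k lek z; rewrite inE => /orP[/eqP->//|zs Qz].
    exact: maxx0.
  have [lt|le] := boolP ((a x0 < a y) || ((a x0 == a y) && (b x0 <= b y))).
    exists y; split; rewrite ?mem_head //.
    exists (k0 + `|b x0 - b y|)%N => k lek z; rewrite inE => /orP[/eqP->//|zs Qz].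
    have le0 : (k0 <= k)%N by lia.
    apply: le_trans (maxx0 _ le0 _ zs Qz) _.
    case/orP: lt => [lt|/andP[/eqP-> ?]]; last by rewrite lerD2l.
    by have : (a y - a x0 - 1) * k%:Z >= 0 by [rewrite mulr_ge0; lia]; nia.
  exists x0; split=> //.
  exists (k0 + `|b x0 - b y|)%N => k lek z; rewrite inE => /orP[/eqP->|zs] Qz.
    move: le; rewrite negb_or -leNgt negb_and le_eqVlt => /andP[/orP[/eqP->|lt]].
      by rewrite eqxx /= -ltNge => /ltW; rewrite lerD2l.
    by have : (a x0 - a y - 1) * k%:Z >= 0 by [rewrite mulr_ge0; lia]; nia.
  by apply: maxx0 => //; lia.
have Qy : Q y.
  by move: xs Qx; rewrite inE => /orP[/eqP->//|xs Qx]; case: none; exists x.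
exists y; split; rewrite ?mem_head //; exists 0%N => k _ z.
by rewrite inE => /orP[/eqP->//|zs Qz]; case: none; exists z.
Qed.

(** * Monomials *)

Section Monomials.
Variable m : nat.
Implicit Types (u p : 'X_{1..m}).

(** Induction on the number [l] of compared coordinates. If [s] serves for the first [l] of them and
    [t] bounds coordinate [l] on [s], only the elements with that coordinate below [t] remain, and
    they fall into [t] slices on which it is constant. *)
Lemma dickson_prefix (l : nat) (A : 'X_{1..m} -> Prop) :
  exists s : seq 'X_{1..m}, (forall x, x \in s -> A x) /\
    forall u, A u -> exists2 x, x \in s & forall i : 'I_m, (i < l)%N -> (x i <= u i)%N.
Proof.
elim: l A => [|l IH] A.
  case: (classic (exists u, A u)) => [[u Au]|none].
    by exists [:: u]; split=> [x|v _]; [rewrite inE => /eqP-> | exists u; rewrite ?mem_head].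
  by exists [::]; split=> // u Au; case: none; exists u.
have [lelm|ltlm] := leqP m l.
  have [s [sA sP]] := IH A; exists s; split=> // u /sP [x xs xu].
  by exists x => // i _; apply: xu; apply: leq_trans (ltn_ord i) lelm.
pose o := Ordinal ltlm.
have [s [sA sP]] := IH A.
pose t := \max_(x <- s) (x o : nat).
have slices h : exists s' : seq 'X_{1..m}, (forall x, x \in s' -> A x) /\
    forall u, A u -> (u o < h)%N ->
      exists2 x, x \in s' & forall i : 'I_m, (i < l.+1)%N -> (x i <= u i)%N.
  elim: h => [|h [s1 [s1A s1P]]]; first by exists [::].
  have [s2 [s2A s2P]] := IH (fun u => A u /\ u o = h).
  exists (s1 ++ s2); split=> [x|u Au].
    by rewrite mem_cat => /orP[/s1A|/s2A[]].
  rewrite ltnS leq_eqVlt => /orP[/eqP uh|lt].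
    have [x xs xu] := s2P u (conj Au uh); exists x; rewrite ?mem_cat ?xs ?orbT //.
    move=> i; rewrite ltnS leq_eqVlt => /orP[/eqP il|]; last exact: xu.
    have -> : i = o by apply: val_inj.
    by rewrite uh; have [_ ->] := s2A _ xs.
  by have [x xs xu] := s1P u Au lt; exists x; rewrite ?mem_cat ?xs.
have [s' [s'A s'P]] := slices t.
exists (s ++ s'); split=> [x|u Au]; first by rewrite mem_cat => /orP[/sA|/s'A].
have [let_u|ltu] := leqP t (u o); last first.
  by have [x xs xu] := s'P u Au ltu; exists x; rewrite ?mem_cat ?xs ?orbT.
have [x xs xu] := sP u Au; exists x; rewrite ?mem_cat ?xs //.
move=> i; rewrite ltnS leq_eqVlt => /orP[/eqP il|]; last exact: xu.
have -> : i = o by apply: val_inj.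
by apply: leq_trans let_u; rewrite /t (big_rem _ xs) leq_maxl.
Qed.

Lemma dickson (A : 'X_{1..m} -> Prop) :
  exists s : seq 'X_{1..m}, (forall x, x \in s -> A x) /\
    forall u, A u -> exists2 x, x \in s & (x <= u)%MM.
Proof.
have [s [sA sP]] := dickson_prefix m A; exists s; split=> // u /sP [x xs xu].
by exists x => //; apply/mnm_lepP => i; apply: xu.
Qed.

Definition mtrunc (c : nat) u : 'X_{1..m} := [multinom minn (u i) c | i < m].

(** The exponents of the finitely many minimal elements are at most [c0], so truncation at [c] does
    not affect which of them divide [u]. *)
Lemma upset_trunc (A : 'X_{1..m} -> Prop) :
  (forall u v, (u <= v)%MM -> A u -> A v) ->
  exists c0 : nat, forall c u, (c0 <= c)%N -> (A u <-> A (mtrunc c u)).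
Proof.
move=> Aup; have [s [sA sP]] := dickson A.
exists (\max_(x <- s) mdeg x) => c u lec; split=> [/sP [x xs /mnm_lepP xu]|].
  apply: Aup (sA _ xs); apply/mnm_lepP => i; rewrite mnmE leq_min xu /=.
  apply: leq_trans lec; apply: (@leq_trans (mdeg x)).
    by rewrite mdegE (bigD1 i) //= leq_addr.
  by rewrite (big_rem _ xs) leq_maxl.
by apply: Aup; apply/mnm_lepP => i; rewrite mnmE geq_minl.
Qed.

(** Both gradings of [K[x, y]] have this form: one weighs a variable by the degree of its image in
    [S], the other by the power of [I] it carries, 0 or 1. *)
Definition wdeg (e : 'I_m -> nat) u : nat := \sum_i e i * u i.

Lemma wdeg0 e : wdeg e 0%MM = 0%N.
Proof. by rewrite /wdeg big1 // => i _; rewrite mnm0E muln0. Qed.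

Lemma wdegD e : {morph wdeg e : u v / (u + v)%MM >-> (u + v)%N}.
Proof.
by move=> u v; rewrite /wdeg -big_split; apply: eq_bigr => i _; rewrite mnmDE mulnDr.
Qed.

HB.instance Definition _ e := isMeasure.Build m (wdeg e) (wdeg0 e) (wdegD e).

Lemma wdegU e i : wdeg e U_(i)%MM = e i.
Proof.
rewrite /wdeg (bigD1 i) //= mnm1E eqxx muln1 big1 ?addn0 // => j.
by rewrite mnm1E eq_sym => /negbTE->; rewrite muln0.
Qed.

Lemma wdegMn e u t : wdeg e (u *+ t)%MM = (wdeg e u * t)%N.
Proof. by elim: t => [|t IH]; rewrite ?mulm0n ?wdeg0 ?muln0 // mulmS wdegD IH mulnS. Qed.

(** * Extremal weights on a set of monomials decided by truncated exponents; [kap] marks the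
    [y]-variables *)

Section TruncationInvariant.
Variables (kap : 'I_m -> bool) (D : 'X_{1..m} -> Prop) (c : nat).
Local Notation kdeg := (wdeg (fun i => nat_of_bool (kap i))).
Hypothesis Dtrunc : forall u, D u <-> D (mtrunc c u).
Hypothesis Dkap : forall u i, D u -> ~~ kap i -> ~ D (u + U_(i))%MM.

Lemma mtruncDU u i t : (c <= u i)%N -> mtrunc c (u + U_(i) *+ t)%MM = mtrunc c u.
Proof.
move=> leci; apply/mnmP => j; rewrite !mnmE mulmnE mnm1E.
by case: eqP => [<-|_] /=; lia.
Qed.

(** Once the exponent reaches [c], multiplying by the variable leaves the truncation unchanged, so
    the product would stay in [D], against [Dkap]. *)
Lemma trunc_inv_lt u i : D u -> ~~ kap i -> (u i < c)%N.
Proof.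
move=> Du nki; rewrite ltnNge; apply/negP => leci; apply: (Dkap Du nki).
by apply/(proj2 (Dtrunc _)); rewrite -[U_(i)%MM]mulm1n mtruncDU //; apply/(proj1 (Dtrunc _)).
Qed.

Lemma trunc_inv_bounded (e : 'I_m -> nat) (k : nat) :
  exists B, forall u, D u -> kdeg u = k -> (wdeg e u <= B)%N.
Proof.
exists (\sum_i e i * (c + k)%N)%N => u Du kdu; apply: leq_sum => i _; rewrite leq_mul2l; apply/orP; right.
case: (boolP (kap i)) => ki; last by have := trunc_inv_lt Du ki; lia.
by apply: leq_trans (leq_addl _ _); rewrite -kdu /wdeg (bigD1 i) //= ki mul1n leq_addr.
Qed.

Variable e : 'I_m -> int.
Let w u : int := \sum_i e i * (u i)%:Z.

(** The excess of [u] over its truncation sits on marked variables of exponent at least [c]. Moving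
    all of it onto the one with the largest [e] does not lower the weight, and the right-hand side
    is the weight after the move. *)
Lemma trunc_inv_dominated u : D u -> (m * c < kdeg u)%N ->
  exists i, [/\ kap i, mtrunc c u i = c & w u <=
    e i * (kdeg u)%:Z + (w (mtrunc c u) - e i * (kdeg (mtrunc c u))%:Z)].
Proof.
move=> Du ltk.
have [i0 lei0] : exists i, (c <= u i)%N.
  case: (pickP (fun i => c <= u i)%N) => [i|none]; first by exists i.
  move: ltk; rewrite ltnNge; case/negP.
  apply: (@leq_trans (\sum_(i < m) c)%N); last by rewrite sum_nat_const card_ord.
  apply: leq_sum => i _; have := none i; case: (kap i) => /=; lia.
case: (@arg_maxP _ _ _ i0 (fun j => (c <= u j)%N) e lei0) => i leci maxi.
have ki : kap i by apply: contraLR leci => nki; rewrite -ltnNge trunc_inv_lt.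
exists i; split=> //; first by rewrite mnmE; lia.
have -> : e i * (kdeg u)%:Z + (w (mtrunc c u) - e i * (kdeg (mtrunc c u))%:Z)
   = w (mtrunc c u) + \sum_j e i * (u j - c)%N%:Z.
  rewrite -mulr_sumr addrCA -mulrBr; congr (_ + _ * _).
  rewrite /wdeg !(big_morph Posz PoszD (erefl 0)) -sumrB; apply: eq_bigr => j _.
  rewrite mnmE; case: (boolP (kap j)) => kj; first by rewrite !mul1n; lia.
  by have := trunc_inv_lt Du kj; rewrite !mul0n; lia.
rewrite /w -big_split; apply: ler_sum => j _; rewrite /= mnmE.
have [lecj|ltjc] := leqP c (u j).
  have -> : (u j)%:Z = c%:Z + (u j - c)%N%:Z by lia.
  by rewrite mulrDr lerD2l ler_wpM2r //; apply: maxi.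
by rewrite (eqP (ltnW ltjc)) mulr0 addr0.
Qed.

(** There are finitely many pairs of a truncated monomial in [D] and a variable of exponent [c] in
    it. Each gives an affine function of [k] that is attained, and together these functions dominate
    the weight. *)
Lemma trunc_inv_eventually_linear :
  (exists k0 : nat, forall k, (k0 <= k)%N -> exists2 u, D u & kdeg u = k) ->
  exists (a b : int) (k0 : nat), forall k : nat, (k0 <= k)%N ->
    (exists u, [/\ D u, kdeg u = k & w u = a * k%:Z + b]) /\
    (forall u, D u -> kdeg u = k -> w u <= a * k%:Z + b).
Proof.
case=> k0 Dne.
pose mono (f : {ffun 'I_m -> 'I_c.+1}) : 'X_{1..m} := [multinom (f j : nat) | j < m].
pose Q (q : {ffun 'I_m -> 'I_c.+1} * 'I_m) := D (mono q.1) /\ mono q.1 q.2 = c.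
pose a (q : {ffun 'I_m -> 'I_c.+1} * 'I_m) : int := e q.2.
pose b (q : {ffun 'I_m -> 'I_c.+1} * 'I_m) : int :=
  w (mono q.1) - e q.2 * (kdeg (mono q.1))%:Z.
have dom u : D u -> (m * c < kdeg u)%N ->
    exists2 q, Q q & w u <= a q * (kdeg u)%:Z + b q.
  move=> Du ltk; have [i [ki ic le]] := trunc_inv_dominated Du ltk.
  pose f : {ffun 'I_m -> 'I_c.+1} := [ffun j => inord (mtrunc c u j)].
  have fE : mono f = mtrunc c u.
    by apply/mnmP => j; rewrite mnmE ffunE inordK // mnmE ltnS geq_minr.
  by exists (f, i); rewrite /Q /a /b /= fE //; split=> //; apply/(proj1 (Dtrunc _)).
(* Raising the exponent that already equals [c] preserves the truncation, hence membership in [D],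
   and reaches every larger [kdeg]. *)
have att q k : Q q -> (kdeg (mono q.1) <= k)%N ->
    exists u, [/\ D u, kdeg u = k & w u = a q * k%:Z + b q].
  case: q => f i [/= Df fi] lek; set p := mono f in Df fi lek *.
  have ki : kap i by apply: contraT => /(trunc_inv_lt Df); rewrite fi ltnn.
  pose t := (k - kdeg p)%N.
  have kD : kdeg (p + U_(i) *+ t)%MM = k.
    by rewrite wdegD wdegMn wdegU ki mul1n subnKC.
  exists (p + U_(i) *+ t)%MM; split=> //.
    by apply/(proj2 (Dtrunc _)); rewrite mtruncDU ?fi //; apply/(proj1 (Dtrunc _)).
  rewrite /w (eq_bigr (fun j => e j * (p j)%:Z + (if j == i then e i * t%:Z else 0))).
    rewrite big_split /= -big_mkcond big_pred1_eq -/(w p) /a /b /= -/p.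
    have -> : t%:Z = k%:Z - (kdeg p)%:Z by rewrite /t; lia.
    by ring.
  move=> j _; rewrite mnmDE mulmnE mnm1E PoszD mulrDr eq_sym.
  by case: eqP => [->|_] /=; rewrite ?mul1n // mul0n mulr0.
have [|q0 [_ Qq0 [k1 max0]]] :=
    @eventually_max _ (enum {: {ffun 'I_m -> 'I_c.+1} * 'I_m}) Q a b.
  have [|u Du kdu] := Dne (k0 + (m * c).+1)%N; first by rewrite leq_addr.
  by have [|q Qq _] := dom u Du; [rewrite kdu; lia | exists q; rewrite ?mem_enum].
(* The three summands ensure, in order, that [q0] is maximal, that [dom] applies, and that [att]
   applies to [q0]. *)
exists (a q0), (b q0), (k1 + (m * c).+1 + kdeg (mono q0.1))%N => k lek.
split=> [|u Du kdu]; first by apply: att => //; apply: leq_trans lek; apply: leq_addl.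
have [|q Qq le] := dom u Du; first by rewrite kdu; lia.
by rewrite kdu in le; apply: le_trans le _; apply: max0; rewrite ?mem_enum //; lia.
Qed.

End TruncationInvariant.
End Monomials.

(** * Graded ideals *)

Section GradedIdeals.
Variables (K : fieldType) (n : nat).
Local Notation S := {mpoly K[n]}.
Implicit Types (I J L P : subS K n) (f g h p q : S).

Local Notation hcomp := (pihomog (@mdeg n)).

Lemma hcomp_homog d p : is_homog d (hcomp d p).
Proof. exact: pihomogP. Qed.

Lemma hcomp_id d p : is_homog d p -> hcomp d p = p.
Proof. exact: pihomog_dE. Qed.

Lemma hcomp_ne d e p : is_homog d p -> d != e -> hcomp e p = 0.
Proof. by move=> hp ne; apply: pihomog_ne0 ne hp. Qed.

Lemma hcomp_big d p : (msize p <= d)%N -> hcomp d p = 0.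
Proof.
move=> le; rewrite pihomogE big_seq_cond big1 // => u /andP[/msize_mdeg_lt lt /eqP du].
by move: lt; rewrite du ltnNge le.
Qed.

Lemma hcomp_sum p : p = \sum_(d < msize p) hcomp d p.
Proof. exact: pihomog_partitionE. Qed.

(** By bilinearity this reduces to two monomials, where only the index [mdeg u] can contribute. *)
Lemma hcompM d p q :
  hcomp d (p * q) = \sum_(i < d.+1) hcomp i p * hcomp (d - i) q.
Proof.
elim/mpolyind: p => [|c u p _ _ IH].
  by rewrite mul0r raddf0 big1 // => i _; rewrite raddf0 mul0r.
rewrite mulrDl raddfD /= IH -scalerAl.
under [RHS]eq_bigr do rewrite raddfD mulrDl.
rewrite big_split /=; congr (_ + _) => {IH p}.
elim/mpolyind: q => [|c' v q _ _ IH].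
  by rewrite mulr0 scaler0 raddf0 big1 // => i _; rewrite raddf0 mulr0.
rewrite mulrDr scalerDr raddfD /= IH.
under [RHS]eq_bigr do rewrite raddfD mulrDr.
rewrite big_split /=; congr (_ + _) => {IH q}.
rewrite -scalerAr -mpolyXD !linearZ /= pihomogX mfD /=.
under eq_bigr do rewrite !linearZ /= !pihomogX.
have [ltdu|leud] := ltnP d (mdeg u).
  rewrite big1 ?gtn_eqF ?scaler0 //; first by lia.
  move=> i _; rewrite gtn_eqF ?scaler0 ?mul0r //.
  by apply: leq_ltn_trans ltdu; rewrite -ltnS.
rewrite -ltnS in leud; rewrite (bigD1 (Ordinal leud)) //= eqxx big1 ?addr0.
  have -> : (mdeg v == d - mdeg u)%N = (mdeg u + mdeg v == d)%N by lia.
  case: ifP => _; last by rewrite !scaler0 mulr0.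
  by rewrite mpolyXD -scalerAl -scalerAr.
move=> i ne; rewrite ifN ?scaler0 ?mul0r //.
by apply: contra ne => /eqP ui; apply/eqP/val_inj.
Qed.

Lemma hcompMl d e h p : is_homog e h -> hcomp (e + d) (h * p) = h * hcomp d p.
Proof.
move=> hh; have lt : (e < (e + d).+1)%N by lia.
rewrite hcompM (bigD1 (Ordinal lt)) //= hcomp_id // addKn big1 ?addr0 // => i ne.
rewrite (hcomp_ne hh) ?mul0r //; apply: contra ne => /eqP ei.
by apply/eqP/val_inj.
Qed.

Lemma hcompMl_lt d e h p : is_homog e h -> (d < e)%N -> hcomp d (h * p) = 0.
Proof.
move=> hh lt; rewrite hcompM big1 // => i _.
by rewrite (hcomp_ne hh) ?mul0r // gtn_eqF //; have := ltn_ord i; lia.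
Qed.

Lemma homog1 : is_homog 0 (1 : S).
Proof. exact: dhomog1. Qed.

Lemma homog0 d : is_homog d (0 : S).
Proof. exact: dhomog0. Qed.

Lemma homogXi i : is_homog 1 ('X_i : S).
Proof. by rewrite /is_homog dhomogX /= mdeg1. Qed.

Lemma homogM d e p q : is_homog d p -> is_homog e q -> is_homog (d + e) (p * q).
Proof. exact: dhomogM. Qed.

(** Gradedness in terms of components rather than generators, a form that passes directly to colon
    ideals. *)
Definition graded I := is_gideal I /\ forall d f, I f -> I (hcomp d f).

Lemma gidealB I : is_gideal I -> forall a b, I a -> I b -> I (a - b).
Proof. by case=> I0 ID IM a b Ia Ib; apply: ID => //; rewrite -mulN1r; apply: IM. Qed.

Lemma gidealMr I : is_gideal I -> forall a r, I a -> I (a * r).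
Proof. by case=> I0 ID IM a r Ia; rewrite mulrC; apply: IM. Qed.

Lemma gideal_sum I (T : Type) (r : seq T) (A : pred T) (F : T -> S) :
  is_gideal I -> (forall i, A i -> I (F i)) -> I (\sum_(i <- r | A i) F i).
Proof. by case=> I0 ID _ IF; apply: big_ind. Qed.

Lemma gideal_hcomp I : is_gideal I -> forall f, (forall d, I (hcomp d f)) -> I f.
Proof. by move=> idI f If; rewrite (hcomp_sum f); apply: gideal_sum. Qed.

Lemma gen_ideal_gideal (G : subS K n) : is_gideal (gen_ideal G).
Proof.
split=> [|a b [s [sG ->]] [t [tG ->]]|r a [s [sG ->]]].
- by exists [::]; rewrite big_nil.
- exists (s ++ t); rewrite big_cat; split=> // q.
  by rewrite mem_cat => /orP[/sG|/tG].
- exists [seq (r * z.1, z.2) | z <- s]; split=> [z /mapP[z' /sG ? ->]//|].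
  by rewrite big_map mulr_sumr; apply: eq_bigr => z _; rewrite mulrA.
Qed.

Lemma gen_ideal_sub (G : subS K n) g : G g -> gen_ideal G g.
Proof.
move=> Gg; exists [:: (1, g)]; rewrite big_seq1 mul1r.
by split=> // q; rewrite inE => /eqP->.
Qed.

Lemma gen_ideal_min (G : subS K n) L :
  is_gideal L -> (forall g, G g -> L g) -> forall f, gen_ideal G f -> L f.
Proof.
move=> [L0 LD LM] GL f [s [sG ->]]; rewrite big_seq_cond.
by apply: big_ind => // q /andP[/sG/GL]; auto.
Qed.

(** [L] need not be graded: a component of [r * a] of degree at most [d] only involves components of
    [a] of degree at most [d]. *)
Lemma gideal_hcomp_le L d :
  is_gideal L -> is_gideal (fun x => forall e, (e <= d)%N -> L (hcomp e x)).
Proof.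
move=> idL; have [L0 LD LM] := idL; split=> [e _|a b La Lb e le|r a La e le].
- by rewrite raddf0.
- by rewrite raddfD; apply: LD; [apply: La | apply: Lb].
- by rewrite hcompM; apply: gideal_sum => // i _; apply: LM; apply: La; lia.
Qed.

Lemma gideal_mulr L b : is_gideal L -> is_gideal (fun x => L (x * b)).
Proof.
move=> [L0 LD LM]; split=> [|x y Lx Ly|r x Lx]; rewrite ?mul0r ?mulrDl -?mulrA //; [exact: LD | exact: LM].
Qed.

Lemma graded_gen (G : subS K n) :
  (forall g, G g -> forall d, gen_ideal G (hcomp d g)) -> graded (gen_ideal G).
Proof.
move=> Gh; split=> [|d]; first exact: gen_ideal_gideal.
move=> f Gf; apply: (gen_ideal_min (@gideal_hcomp_le _ d (gen_ideal_gideal G)) _ Gf) => //.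
by move=> g Gg e _; apply: Gh.
Qed.

Lemma eq_graded I J : same_set I J -> graded I -> graded J.
Proof.
move=> IJ [[I0 ID IM] Ih]; split; first split.
- exact/IJ.
- by move=> a b /IJ Ia /IJ Ib; apply/IJ; apply: ID.
- by move=> r a /IJ Ia; apply/IJ; apply: IM.
- by move=> d f /IJ If; apply/IJ; apply: Ih.
Qed.

Lemma graded_idealP I : graded_ideal I -> graded I.
Proof.
case=> G [Gh IG]; apply: (@eq_graded (gen_ideal G)) => [f|]; first by rewrite IG.
apply: graded_gen => g Gg d; have [e he] := Gh g Gg.
have [<-|ne] := eqVneq e d; first by rewrite hcomp_id //; apply: gen_ideal_sub.
by rewrite (hcomp_ne he ne); case: (gen_ideal_gideal G).
Qed.

Lemma graded_mul I J : graded I -> graded J -> graded (ideal_mul I J).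
Proof.
move=> [idI Ih] [idJ Jh]; apply: graded_gen => _ [a [b [Ia [Jb ->]]]] d.
rewrite hcompM; apply: gideal_sum => [|i _]; first exact: gen_ideal_gideal.
by apply: gen_ideal_sub; exists (hcomp i a), (hcomp (d - i) b); auto.
Qed.

Lemma graded_pow I k : graded I -> graded (ideal_pow I k).
Proof.
move=> grI; elim: k => [|k IH] /=; last exact: graded_mul.
apply: graded_gen => _ -> d.
have [<-|ne] := eqVneq 0%N d; last first.
  by rewrite (hcomp_ne homog1 ne); case: (gen_ideal_gideal (fun g : S => g = 1)).
by rewrite hcomp_id; [apply: gen_ideal_sub | apply: homog1].
Qed.

Lemma ideal_mulP I J a b : I a -> J b -> ideal_mul I J (a * b).
Proof. by move=> Ia Jb; apply: gen_ideal_sub; exists a, b. Qed.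

Lemma ideal_mul_min I J L : is_gideal L ->
  (forall a b, I a -> J b -> L (a * b)) -> forall f, ideal_mul I J f -> L f.
Proof. by move=> idL IJ; apply: gen_ideal_min => // _ [a [b [Ia [Jb ->]]]]; apply: IJ. Qed.

(** The product of [hcomp d f] and a component of [h] is a component of [f] times that component,
    which lies in [P] because [P] is graded. *)
Lemma graded_colon I P : graded I -> graded P -> graded (colon I P).
Proof.
move=> [idI Ih] [idP Ph]; have [I0 ID IM] := idI; split; first split.
- by move=> h _; rewrite mul0r.
- by move=> a b Ja Jb h Phh; rewrite mulrDl; apply: ID; [apply: Ja | apply: Jb].
- by move=> r a Ja h Phh; rewrite -mulrA; apply: IM; apply: Ja.
move=> d f Jf h Phh; apply: gideal_hcomp => // e; rewrite hcompM.
apply: gideal_sum => // i _; have [->|ne] := eqVneq d i; last first.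
  by rewrite (hcomp_ne (hcomp_homog d f) ne) mul0r.
rewrite hcomp_id; last exact: hcomp_homog.
rewrite mulrC -(hcompMl _ _ (hcomp_homog _ _)); apply: Ih; rewrite mulrC.
exact/Jf/Ph.
Qed.

(* Comparing degree d parts in m J + I only involves elements of J of degree below d. *)
Lemma nakayama_step I J L d : graded I -> graded J -> is_gideal L ->
  (forall f, I f -> L f) ->
  (forall e h, (e < d)%N -> is_homog e h -> J h -> L h) ->
  forall g, is_homog d g -> ideal_add (ideal_mul (@max_ideal K n) J) I g -> L g.
Proof.
move=> [idI Ih] [idJ Jh] idL IL JL g hg Ng; rewrite -(hcomp_id hg).
apply: (gen_ideal_min (gideal_hcomp_le d idL) _ Ng) => // {hg Ng}g [mJg|Ig] e le; last first.
  by apply: IL; apply: Ih.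
move: g mJg e le; apply: ideal_mul_min; first exact: gideal_hcomp_le.
move=> a b ma Jb; move: a ma.
apply: (gen_ideal_min (gideal_mulr b (gideal_hcomp_le d idL))).
(* Multiplication by ['X_i] raises degrees by one, so degree 0 gives nothing and degree [e.+1] comes
   from degree [e] of [b]. *)
move=> _ [i ->] [|e] le.
  by rewrite (hcompMl_lt _ (homogXi i)) //; case: idL.
rewrite -add1n (hcompMl _ _ (homogXi i)); case: (idL) => _ _; apply.
by apply: JL (hcomp_homog e b) (Jh _ _ Jb).
Qed.

(** The top component of an element of [P] is shown to lie in [P]; subtracting it and repeating
    handles the other components. *)
Lemma Ass_graded I P : graded I -> Ass I P -> graded P.
Proof.
move=> [idI Ih] [[idP P1 prP] [f fP]]; have [I0 ID IM] := idI.
have [P0 PD PM] := idP.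
(* Multiplying the witness by the top component of [a] kills its own top component modulo I. *)
have top a d : P a -> (forall e, (d < e)%N -> hcomp e a = 0) -> P (hcomp d a).
  move=> Pa atop; apply: NNPP => nPad.
  (* [N] bounds the number of degrees, from [s] on, in which the witness [g] may have components
     outside [I]; with none left, [g] would lie in [I]. *)
  suff Q N : forall s g, (forall x, I (x * g) <-> P x) ->
      (forall e, (s + N <= e)%N -> I (hcomp e g)) ->
      (forall e, (e < s)%N -> hcomp e g = 0) -> False.
    apply: (Q (msize f) 0%N f fP) => // e le; by rewrite hcomp_big.
  elim: N => [|N IH] s g gP gI g0.
    apply: P1; apply/gP; rewrite mul1r; apply: gideal_hcomp => // e.
    have [lt|le] := ltnP e s; first by rewrite g0.
    by apply: gI; rewrite addn0.
  (* In degree [d + (s + N)] of [a * g], higher components of [a] vanish and lower ones meet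
     components of [g] lying in [I]. *)
  have Itop : I (hcomp d a * hcomp (s + N) g).
    have lt : (d < (d + (s + N)).+1)%N by lia.
    have := Ih (d + (s + N))%N (a * g) ((gP a).2 Pa).
    rewrite hcompM (bigD1 (Ordinal lt)) //= addKn => Iag.
    rewrite -[_ * _](addrK (\sum_(i < (d + (s + N)).+1 | i != Ordinal lt)
       hcomp i a * hcomp (d + (s + N) - i) g)).
    apply: gidealB => //; apply: gideal_sum => // i ne.
    have [ltdi|leid] := ltnP d i; first by rewrite atop ?mul0r.
    apply: IM; apply: gI; have : (i : nat) != d by [].
    lia.
  (* This is again a witness, as [P] is prime and [hcomp d a] lies outside it, and its range of
     degrees has lost the top one. *)
  apply: (IH (s + d)%N (hcomp d a * g)) => [x|e le|e lt].
  - rewrite mulrA gP; split=> [/prP[]//|Px]; rewrite mulrC; exact: PM.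
  - have -> : e = (d + (e - d))%N by lia.
    rewrite (hcompMl _ _ (hcomp_homog d a)).
    have [<-|ne] := eqVneq (s + N)%N (e - d)%N; first by [].
    by apply: IM; apply: gI; lia.
  - have [ltd|led] := ltnP e d; first by rewrite (hcompMl_lt _ (hcomp_homog d a)).
    have -> : e = (d + (e - d))%N by lia.
    by rewrite (hcompMl _ _ (hcomp_homog d a)) g0 ?mulr0 //; lia.
suff all N : forall a, P a -> (forall e, (N <= e)%N -> hcomp e a = 0) ->
    forall d, P (hcomp d a).
  by split=> // d a Pa; apply: (all (msize a)) => // e; apply: hcomp_big.
elim: N => [|N IH] a Pa a0 d; first by rewrite a0.
have PN : P (hcomp N a) by apply: top => // e; apply: a0.
have hE e : hcomp e (a - hcomp N a) = if e == N then 0 else hcomp e a.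
  rewrite raddfB /=; have [->|ne] := eqVneq e N.
    by rewrite [X in _ - X]hcomp_id ?subrr //; apply: hcomp_homog.
  by rewrite [X in _ - X](hcomp_ne (hcomp_homog N a)) ?subr0 // eq_sym.
have [->//|ne] := eqVneq d N.
have := IH (a - hcomp N a) (gidealB idP Pa PN) _ d; rewrite hE (negbTE ne); apply.
by move=> e le; rewrite hE; case: eqP => // neN; apply: a0; lia.
Qed.

(** [P] kills every component of a witness modulo [I]. If no component were a witness, each would be
    killed by some element outside [P]; the product of these elements lies outside [P] and kills the
    whole witness. *)
Lemma Ass_homog_witness I P : graded I -> Ass I P ->
  exists d f, is_homog d f /\ same_set (colon_elt I f) P.
Proof.
move=> grI AP; have [_ Ph] := Ass_graded grI AP.
have [idI Ih] := grI; have [[idP P1 prP] [f fP]] := AP.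
have PI e x : P x -> I (x * hcomp e f).
  move=> Px; rewrite mulrC; apply: gideal_hcomp => // d; rewrite mulrC.
  have -> : hcomp d (x * hcomp e f) =
      if (e <= d)%N then hcomp e f * hcomp (d - e) x else 0.
    rewrite mulrC; case: leqP => [le|lt]; last by rewrite (hcompMl_lt _ (hcomp_homog e f)).
    by rewrite -{1}(subnKC le) (hcompMl _ _ (hcomp_homog e f)).
  case: leqP => le; last by case: idI.
  rewrite mulrC -(hcompMl _ _ (hcomp_homog (d - e) x)); apply: Ih.
  exact/fP/Ph.
apply: NNPP => none.
have esc e : exists2 x, ~ P x & I (x * hcomp e f).
  apply: NNPP => noesc; apply: none; exists e, (hcomp e f).
  split; first exact: hcomp_homog.
  move=> x; split; last exact: PI.
  by move=> Ix; apply: NNPP => nPx; apply: noesc; exists x.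
have [x nPx xI] : exists2 x, ~ P x & forall e, (e < msize f)%N -> I (x * hcomp e f).
  elim: (msize f) => [|N [x nPx xI]]; first by exists 1.
  have [y nPy yI] := esc N; exists (x * y) => [/prP[]//|e].
  rewrite ltnS leq_eqVlt => /orP[/eqP->|lt].
    by rewrite -mulrA; case: idI => _ _; apply.
  by rewrite mulrAC; apply: gidealMr => //; apply: xI.
apply: nPx; apply/fP; rewrite /colon_elt (hcomp_sum f) mulr_sumr.
by apply: gideal_sum => // e _; apply: xI.
Qed.

(** This is the kernel of the map from [S] to the localization of [S / I] at [P]. *)
Lemma torsion_gideal I P : is_gideal I -> prime_gideal P ->
  is_gideal (fun g => exists a, ~ P a /\ I (a * g)).
Proof.
move=> idI [idP P1 prP]; have [I0 ID IM] := idI; split.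
- by exists 1; rewrite mulr0.
- move=> g h [a [nPa Ia]] [b [nPb Ib]]; exists (a * b); split; first by case/prP.
  by rewrite mulrDr; apply: ID; [rewrite mulrAC; apply: gidealMr | rewrite -mulrA; apply: IM].
- by move=> r g [a [nPa Ia]]; exists a; rewrite mulrCA; auto.
Qed.

(** * Degrees of minimal generators of [(Q : P) / Q] and degrees of witnesses *)

Section Socle.
Variables (Q P : subS K n).
Hypotheses (grQ : graded Q) (AP : Ass Q P).
Let J := colon Q P.
Let N := ideal_add (ideal_mul (@max_ideal K n) J) Q.

Definition gen_degree (d : nat) := exists f, is_homog d f /\ J f /\ ~ N f.

Let grP := Ass_graded grQ AP.
Let grJ : graded J := graded_colon grQ grP.

Lemma witness_colon f : same_set (colon_elt Q f) P -> J f /\ ~ Q f.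
Proof.
move=> fP; split=> [h Phh|Qf]; first by rewrite mulrC; apply/fP.
by case: AP => [[_ P1 _] _]; apply: P1; apply/fP; rewrite /colon_elt mul1r.
Qed.

(** A witness shows that [J / Q] is nonzero. An element of least degree cannot lie in [N], since
    everything of lower degree in [J] is already in [Q]. *)
Lemma alpha_gen_degree : exists d, alpha_is J Q d /\ gen_degree d.
Proof.
have [d0 [f0 [hf0 fP0]]] := Ass_homog_witness grQ AP.
have [Jf0 nQf0] := witness_colon fP0.
have [|d [[f [hf [Jf nQf]]] mind]] :=
    @ex_least (fun d => exists f, is_homog d f /\ J f /\ ~ Q f).
  by exists d0, f0.
have min d' g : is_homog d' g -> J g -> ~ Q g -> (d <= d')%N.
  by move=> hg Jg nQg; apply: mind; exists g.
exists d; split; first by split=> //; exists f.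
exists f; split=> //; split=> // Nf; apply: nQf.
apply: (@nakayama_step Q J Q d) hf Nf => //; first by case: grQ.
by move=> e h lt hh Jh; apply: NNPP => nQh; have := min e h hh Jh nQh; rewrite leqNgt lt.
Qed.

(** The upper bound is phrased with some generator degree; that a largest one exists is deduced
    later from [trunc_inv_bounded]. *)
Lemma vP_bounds : exists v, [/\ vP_is Q P v,
  forall a, alpha_is J Q a -> (a <= v)%N & exists2 d, gen_degree d & (v <= d)%N].
Proof.
have [|v [[f [hf fP]] minv]] :=
    @ex_least (fun d => exists f, is_homog d f /\ same_set (colon_elt Q f) P).
  exact: Ass_homog_witness grQ AP.
have [Jf nQf] := witness_colon fP.
exists v; split.
- by split=> [|d' g hg gP]; [exists f | apply: minv; exists g].
- by move=> a [_ mina]; apply: mina hf Jf nQf.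
apply: NNPP => none; have [prP _] := AP; have [idP P1 _] := prP.
(* Below degree [v], an element of [J] without such an [a] would be a witness of too small a degree.
   From [v] on, [g] lies in [N] and the lower degrees suffice. *)
have tors d : forall g, is_homog d g -> J g -> exists a, ~ P a /\ Q (a * g).
  elim/ltn_ind: d => d IH g hg Jg.
  have [ltdv|levd] := ltnP d v.
    apply: NNPP => notor; suff : (v <= d)%N by rewrite leqNgt ltdv.
    apply: minv; exists g; split=> // x; split=> [Qxg|Px].
      by apply: NNPP => nPx; apply: notor; exists x.
    by rewrite /colon_elt mulrC; apply: Jg.
  have Ng : N g by apply: NNPP => nNg; apply: none; exists d => //; exists g.
  apply: (@nakayama_step Q J (fun x => exists a, ~ P a /\ Q (a * x)) d) hg Ng => //.
  - by apply: torsion_gideal => //; case: grQ.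
  - by move=> x Qx; exists 1; rewrite mul1r.
  - by move=> e h lt hh Jh; apply: IH hh Jh.
by have [a [nPa Qaf]] := tors v f hf Jf; apply: nPa; apply/fP.
Qed.

End Socle.

End GradedIdeals.

(** * Leading monomials and the Rees algebra *)

Section LeadingMonomials.
Variables (K : fieldType) (m : nat).
Implicit Types (v w : {mpoly K[m]}) (V W : {mpoly K[m]} -> Prop).

Lemma mlead_reduce v w : w != 0 -> mlead w = mlead v ->
  let r := v - (mleadc v / mleadc w) *: w in r != 0 -> (mlead r < mlead v)%O.
Proof.
move=> nzw vw r nzr; rewrite lt_neqAle; apply/andP; split; last first.
  apply: le_trans (mleadB_le _ _) _; rewrite leUx lexx /= -vw.
  exact: mleadZ_le.
apply: contraNneq nzr => rv; rewrite -mleadc_eq0 rv mcoeffB mcoeffZ -vw.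
by rewrite divfK ?subrr // mleadc_eq0.
Qed.

(** Division without remainder: subtracting a scalar multiple of an element of [W] with the same
    leading monomial lowers that monomial, and monomials are well-ordered. *)
Lemma lead_subspace V W :
  (forall v w c, V v -> W w -> V (v - c *: w)) ->
  W 0 -> (forall w w' c, W w -> W w' -> W (w + c *: w')) ->
  (forall v, V v -> v != 0 -> exists w, [/\ W w, w != 0 & mlead w = mlead v]) ->
  forall v, V v -> W v.
Proof.
move=> VW W0 WD lead v; elim/mleadrect: v => v IH Vv.
have [->//|nzv] := eqVneq v 0.
have [w [Ww nzw wv]] := lead v Vv nzv.
pose c := mleadc v / mleadc w; pose r := v - c *: w.
have Wr : W r.
  have [->//|nzr] := eqVneq r 0.
  by apply: IH; [apply: mlead_reduce | apply: VW].
by have -> : v = r + c *: w; [rewrite subrK | apply: WD].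
Qed.

End LeadingMonomials.

(** * Homogeneous generators and bihomogeneous preimages *)

Section Rees.
Variables (K : fieldType) (n : nat).
Local Notation S := {mpoly K[n]}.
Local Notation hcomp := (pihomog (@mdeg n)).
Implicit Types (I P : subS K n) (f g : S).

Lemma gidealZ I c f : is_gideal I -> I f -> I (c *: f).
Proof. by move=> [_ _ IM] If; rewrite -mul_mpolyC; apply: IM. Qed.

Lemma homogZB d f g c : is_homog d f -> is_homog d g -> is_homog d (f - c *: g).
Proof. by move=> hf hg; apply: rpredB => //; apply: dhomogZ. Qed.

Lemma homogDZ d f g c : is_homog d f -> is_homog d g -> is_homog d (f + c *: g).
Proof. by move=> hf hg; apply: dhomogD => //; apply: dhomogZ. Qed.

(** Dickson's lemma selects finitely many homogeneous elements whose leading monomials divide all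
    others; division in each fixed degree shows that they generate. *)
Lemma hilbert_homog I : graded I -> exists s : seq S,
  (forall f, f \in s -> I f /\ exists d, is_homog d f) /\
  (forall f, I f -> gen_ideal (fun g => g \in s) f).
Proof.
move=> [idI Ih]; have [I0 ID IM] := idI.
pose A u := exists f d, [/\ I f, is_homog d f, f != 0 & mlead f = u].
have [us [usA usP]] := dickson A.
have [s [sI sP]] : exists s : seq S, (forall f, f \in s -> I f /\ exists d, is_homog d f) /\
    forall u, u \in us -> exists f d, [/\ f \in s, is_homog d f, f != 0 & mlead f = u].
  elim: us usA {usP} => [|u us IH] usA; first by exists [::].
  have [|s [sI sP]] := IH; first by move=> x xs; apply: usA; rewrite inE xs orbT.
  have [f [d [If hf nzf fu]]] := usA u (mem_head _ _).
  exists (f :: s); split=> [g|x]; rewrite inE => /orP[/eqP->|gs].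
  - by split=> //; exists d.
  - exact: sI.
  - by exists f, d; rewrite mem_head.
  - by have [g [e [gs' ? ? ?]]] := sP x gs; exists g, e; rewrite inE gs' orbT.
exists s; split=> // f If; set G := gen_ideal _.
have idG : is_gideal G by apply: gen_ideal_gideal.
have [G0 GD GM] := idG.
have GI g : G g -> I g by apply: gen_ideal_min => // h /sI[].
apply: gideal_hcomp => // d.
pose V g := I g /\ is_homog d g.
(* [V g] is kept in the conclusion because [lead_subspace] needs [V] to be stable under subtracting
   multiples of the smaller set. *)
suff VG g : V g -> V g /\ G g.
  by have [] := VG (hcomp d f) (conj (Ih d f If) (hcomp_homog d f)).
apply: (@lead_subspace _ _ V (fun g => V g /\ G g)) => {f If g}.
- move=> v w c [Iv hv] [[Iw hw] _]; split; last exact: homogZB.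
  by apply: gidealB => //; apply: gidealZ.
- by do !split=> //; apply: homog0.
- move=> v w c [[Iv hv] Gv] [[Iw hw] Gw]; do !split.
  + by apply: ID => //; apply: gidealZ.
  + exact: homogDZ.
  + by apply: GD => //; apply: gidealZ.
move=> v [Iv hv] nzv.
have [|x xs xu] := usP (mlead v); first by exists v, d.
have [f [e [fs hf nzf fx]]] := sP x xs.
pose w : S := 'X_[mlead v - x] * f.
have nzX : 'X_[mlead v - x] != 0 :> S by rewrite -msupp_eq0 msuppX.
have nzw : w != 0 by rewrite mulf_neq0.
have wv : mlead w = mlead v by rewrite mleadM // mleadXm fx submK.
have hw : is_homog (mdeg (mlead v - x) + e) w.
  by apply: homogM => //; rewrite /is_homog dhomogX.
have dE : (mdeg (mlead v - x) + e)%N = d.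
  by have := dhomog_mf hw (mlead_supp nzw); rewrite wv (dhomog_mf hv (mlead_supp nzv)).
have Gw : G w by apply: GM; apply: gen_ideal_sub.
by exists w; do !split=> //; [apply: GI | rewrite -dE].
Qed.

Definition bihomog m (e : 'I_m -> nat) (kap : 'I_m -> bool) (d k : nat)
    (F : {mpoly K[m]}) :=
  F \is ishomog1 d (wdeg e) /\ F \is ishomog1 k (wdeg (fun i => nat_of_bool (kap i))).

Section Bihomog.
Variables (m : nat) (e : 'I_m -> nat) (kap : 'I_m -> bool).
Implicit Types F H : {mpoly K[m]}.

Lemma bihomog0 d k : bihomog e kap d k 0.
Proof. by split; apply: rpred0. Qed.

Lemma bihomog1 : bihomog e kap 0 0 1.
Proof. by split; apply: dhomog1. Qed.

Lemma bihomogD d k F H :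
  bihomog e kap d k F -> bihomog e kap d k H -> bihomog e kap d k (F + H).
Proof. by move=> [? ?] [? ?]; split; apply: rpredD. Qed.

Lemma bihomogZ d k c F : bihomog e kap d k F -> bihomog e kap d k (c *: F).
Proof. by move=> [? ?]; split; apply: rpredZ. Qed.

Lemma bihomogM d k d' k' F H : bihomog e kap d k F -> bihomog e kap d' k' H ->
  bihomog e kap (d + d') (k + k') (F * H).
Proof. by move=> [? ?] [? ?]; split; apply: dhomogM. Qed.

Lemma bihomogX i : bihomog e kap (e i) (kap i) 'X_i.
Proof. by split; rewrite dhomogX /= wdegU. Qed.

Lemma bihomog_mlead d k F : F != 0 -> bihomog e kap d k F ->
  wdeg e (mlead F) = d /\ wdeg (fun i => nat_of_bool (kap i)) (mlead F) = k.
Proof.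
move=> nzF [h1 h2].
by split; [apply: (dhomog_mf h1) | apply: (dhomog_mf h2)]; apply: mlead_supp.
Qed.

End Bihomog.

(** The unmarked variables map to the variables of [S], the marked ones to generators of [I].
    Substitution forgets the Rees variable, so the exponent [k] is recorded by the second degree of
    [F]. *)
Lemma rees_presentation I : graded I ->
  exists (m : nat) (e : 'I_m -> nat) (kap : 'I_m -> bool) (t : m.-tuple S),
  [/\ forall i, is_homog (e i) (tnth t i),
      forall i, kap i -> I (tnth t i),
      forall i, ~~ kap i -> @max_ideal K n (tnth t i) &
      forall k d g, ideal_pow I k g -> is_homog d g ->
        exists F, bihomog e kap d k F /\ F \mPo t = g].
Proof.
move=> grI; have [s [sI sgen]] := hilbert_homog grI.
pose m := (n + size s)%N.
pose x (i : 'I_m) : S := match split i with inl j => 'X_j | inr j => tnth (in_tuple s) j end.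
pose t : m.-tuple S := [tuple x i | i < m].
pose e (i : 'I_m) := (msize (x i)).-1.
pose kap (i : 'I_m) := if split i is inr _ then true else false.
have xh i : is_homog (e i) (x i).
  suff [d] : exists d, is_homog d (x i) by apply: dhomog_msize.
  rewrite /x; case: (split i) => j; first by exists 1%N; apply: homogXi.
  by have [|_ [d hd]] := sI (tnth (in_tuple s) j); [apply: mem_tnth | exists d].
have tE i : tnth t i = x i by rewrite tnth_mktuple.
exists m, e, kap, t; split=> [i|i|i|]; rewrite ?tE //.
- rewrite /kap /x; case: (split i) => // j _.
  by have [] := sI (tnth (in_tuple s) j); first exact: mem_tnth.
- rewrite /kap /x; case: (split i) => // j _.
  by apply: gen_ideal_sub; exists j.
(* Asking for preimages of all components makes [L k] an ideal, and [L] multiplicative in [k];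
   containment of [I^k] then follows by induction. *)
pose L k g := forall d, exists F, bihomog e kap d k F /\ F \mPo t = hcomp d g.
have LD k g h : L k g -> L k h -> L k (g + h).
  move=> Lg Lh d; have [F [bF Fg]] := Lg d; have [H [bH Hh]] := Lh d.
  exists (F + H); split; first exact: bihomogD.
  by rewrite !raddfD /= Fg Hh.
have L0 k : L k 0.
  by move=> d; exists 0; rewrite !raddf0; split=> //; apply: bihomog0.
have LM k k' g h : L k g -> L k' h -> L (k + k')%N (g * h).
  move=> Lg Lh d; rewrite hcompM.
  suff : forall r : seq 'I_d.+1, exists F, bihomog e kap d (k + k') F /\
      F \mPo t = \sum_(i <- r) hcomp i g * hcomp (d - i) h by [].
  elim=> [|i r [F [bF Fr]]].
    by exists 0; rewrite raddf0 big_nil; split=> //; apply: bihomog0.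
  have [G [bG Gg]] := Lg i; have [H [bH Hh]] := Lh (d - i)%N.
  exists (G * H + F); split.
    apply: bihomogD => //; have := bihomogM bG bH; rewrite subnKC //.
    by rewrite -ltnS.
  by rewrite big_cons raddfD /= rmorphM /= Gg Hh Fr.
have Lhom k d F g : bihomog e kap d k F -> F \mPo t = g -> is_homog d g -> L k g.
  move=> bF Fg hg d'; have [<-|ne] := eqVneq d d'.
    by exists F; rewrite hcomp_id.
  by exists 0; rewrite raddf0 (hcomp_ne hg ne); split=> //; apply: bihomog0.
have Lx i : L (kap i) (x i).
  apply: (Lhom _ (e i) 'X_i) (xh i); first exact: bihomogX.
  by rewrite comp_mpolyXU -tnth_nth tE.
have LC c : L 0%N c%:MP.
  apply: (Lhom _ 0%N (c *: 1)).
  - by apply: bihomogZ; apply: bihomog1.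
  - by rewrite -mul_mpolyC mulr1 comp_mpolyC.
  - by rewrite -[c%:MP]mulr1 mul_mpolyC; apply: dhomogZ; apply: homog1.
have LX i : L 0%N 'X_i.
  by have := Lx (unsplit (inl i)); rewrite /kap /x unsplitK.
have Lall g : L 0%N g.
  rewrite (mpolyE g); apply: (big_ind (L 0%N)) => // [|u _]; first exact: LD.
  rewrite -mul_mpolyC -[0%N]addn0; apply: (LM) => //; rewrite mpolyXE_id.
  apply: (big_ind (L 0%N)) => [|a b La Lb|i _]; first exact: (LC 1).
    by rewrite -[0%N]addn0; apply: LM.
  elim: (u i) => [|j IH]; first exact: (LC 1).
  by rewrite exprS -[0%N]addn0; apply: LM.
have idL k : is_gideal (L k).
  by split=> // [|r a La]; [apply: LD | rewrite -[k]add0n; apply: LM].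
have powL k : forall g, ideal_pow I k g -> L k g.
  elim: k => [|k IH] //=.
  apply: ideal_mul_min => // a b Ia /sgen Ib; rewrite mulrC.
  apply: (gen_ideal_min (gideal_mulr a (idL _)) _ Ib) => g gs; rewrite mulrC -addn1.
  apply: LM; first exact: IH.
  have lt : (index g s < size s)%N by rewrite index_mem.
  have := Lx (unsplit (inr (Ordinal lt))); rewrite /kap /x unsplitK.
  by rewrite (tnth_nth 0) /= nth_index.
by move=> k d g /powL Lg hg; have [F [bF Fg]] := Lg d; exists F; rewrite Fg hcomp_id.
Qed.

Lemma homog_nonzero_mem I : graded I -> nonzero_gideal I ->
  exists d b, [/\ is_homog d b, I b & b != 0].
Proof.
move=> [_ Ih] [f [If nzf]]; apply: NNPP => none.
case/eqP: nzf; rewrite (hcomp_sum f) big1 // => d _; apply/eqP.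
apply: contraT => nz; case: none; exists (d : nat), (hcomp d f).
by split=> //; [apply: hcomp_homog | apply: Ih].
Qed.

(** * Generator degrees of [(I^k : P) / I^k] read off from monomials *)

Section GenDegrees.
Variables (I P : subS K n).
Hypotheses (grI : graded I) (nzI : nonzero_gideal I) (grP : graded P).
Hypothesis IP : forall f, I f -> P f.
Local Notation J k := (colon (ideal_pow I k) P).
Local Notation N k := (ideal_add (ideal_mul (@max_ideal K n) (J k)) (ideal_pow I k)).

Let idpow k : is_gideal (ideal_pow I k). Proof. by case: (graded_pow k grI). Qed.
Let idJ k : is_gideal (J k). Proof. by case: (graded_colon (graded_pow k grI) grP). Qed.
Let idN k : is_gideal (N k). Proof. exact: gen_ideal_gideal. Qed.

Lemma max_colon_sub k f : N k f -> J k f.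
Proof.
have [J0 JD JM] := idJ k; apply: gen_ideal_min => // g [].
  by apply: ideal_mul_min => // a b _; apply: JM.
by move=> Ig h Ph; apply: gidealMr.
Qed.

(** With [max_colon_mul], this makes the sums over [k] of [J k] and of [N k] stable under the Rees
    algebra. *)
Lemma colon_pow_mul k f g : I f -> J k g -> J k.+1 (f * g).
Proof.
move=> If Jg h Ph; rewrite -mulrA mulrC; apply: ideal_mulP If.
exact: Jg.
Qed.

Lemma max_colon_mul k f g : I f -> N k g -> N k.+1 (f * g).
Proof.
move=> If; rewrite [f * g]mulrC; move: g.
apply: (gen_ideal_min (gideal_mulr f (idN k.+1))) => g [|Ig]; last first.
  by apply: gen_ideal_sub; right; apply: ideal_mulP.
move: g; apply: (ideal_mul_min (gideal_mulr f (idN k.+1))) => a b ma Jb.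
rewrite -mulrA; apply: gen_ideal_sub; left; apply: ideal_mulP => //.
by rewrite mulrC; apply: colon_pow_mul.
Qed.

(* [D] collects the leading monomials that distinguish [b J_k] from [b N_k] inside
   the Rees algebra; [delta] is the degree of the multiplier [b]. *)
Lemma gen_degree_monomials : exists (m delta c : nat) (e : 'I_m -> nat)
  (kap : 'I_m -> bool) (D : 'X_{1..m} -> Prop),
  [/\ forall u, D u <-> D (mtrunc c u),
      forall u i, D u -> ~~ kap i -> ~ D (u + U_(i))%MM,
      forall k d, gen_degree (ideal_pow I k) P d ->
        exists u, [/\ D u, wdeg (fun i => nat_of_bool (kap i)) u = k &
                      wdeg e u = (d + delta)%N] &
      forall k u, D u -> wdeg (fun i => nat_of_bool (kap i)) u = k ->
        exists2 d, gen_degree (ideal_pow I k) P d & wdeg e u = (d + delta)%N].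
Proof.
have [delta [b [hb Ib nzb]]] := homog_nonzero_mem grI nzI.
have [m [e [kap [t [th tI tmax tsurj]]]]] := rees_presentation grI.
pose kd := wdeg (fun i => nat_of_bool (kap i)).
(* Elements of [J k] may lie outside [I^k] and have no preimage; multiplied by [b], which is in [P],
   they do. *)
pose V (M : nat -> subS K n) d k F := bihomog e kap (d + delta) k F /\
  exists g, [/\ M k g, is_homog d g & F \mPo t = b * g].
pose lead (M : nat -> subS K n) u :=
  exists d F, [/\ V M d (kd u) F, F != 0 & mlead F = u].
pose jj k := J k; pose nn k := N k.
have leadU M M' u i : (forall k g, M k g -> M' (k + kap i)%N (tnth t i * g)) ->
    lead M u -> lead M' (u + U_(i))%MM.
  move=> MM [d [F [[bF [g [Mg hg Fg]]] nzF Fu]]].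
  have nzX : 'X_i != 0 :> {mpoly K[m]} by rewrite -msupp_eq0 msuppX.
  exists (d + e i)%N, (F * 'X_i); split; last 2 first.
  - exact: mulf_neq0.
  - by rewrite mleadM // Fu mleadXm.
  rewrite /kd wdegD wdegU -/(kd u); split.
    by rewrite addnAC; apply: bihomogM => //; apply: bihomogX.
  exists (tnth t i * g); split; first exact: MM.
    by rewrite addnC; apply: homogM.
  by rewrite rmorphM /= Fg comp_mpolyXU -tnth_nth mulrAC mulrA.
have up M : (forall i k g, M k g -> M (k + kap i)%N (tnth t i * g)) ->
    forall u v, (u <= v)%MM -> lead M u -> lead M v.
  move=> MM u v /submK <-; move: (v - u)%MM => w {v}.
  move: {2}(mdeg w) (erefl (mdeg w)) => l; elim: l w => [|l IH] w wl lu.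
    by move/eqP: wl; rewrite mdeg_eq0 => /eqP->; rewrite add0m.
  have [i wi] : exists i, (0 < w i)%N.
    case: (pickP (fun i => 0 < w i)%N) => [i|none]; first by exists i.
    move: wl; rewrite mdegE big1 // => i _.
    by have := none i; rewrite /=; lia.
  have wE : w = (w - U_(i) + U_(i))%MM.
    by rewrite submK //; apply/mnm_lepP => j; rewrite mnm1E; case: eqP => [<-|].
  rewrite wE -addmA [(U_(i) + u)%MM]addmC addmA; apply: leadU (MM i) _; apply: IH => //.
  by move: wl; rewrite {1}wE mdegD mdeg1 addn1 => -[].
have jU i k g : jj k g -> jj (k + kap i)%N (tnth t i * g).
  move=> Jg; case: (boolP (kap i)) => ki.
    by rewrite addn1; apply: colon_pow_mul => //; apply: tI.
  by rewrite addn0; case: (idJ k) => _ _; apply.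
have nU i k g : nn k g -> nn (k + kap i)%N (tnth t i * g).
  move=> Ng; case: (boolP (kap i)) => ki.
    by rewrite addn1; apply: max_colon_mul => //; apply: tI.
  by rewrite addn0; case: (idN k) => _ _; apply.
have [c1 tr1] := upset_trunc (up jj jU).
have [c2 tr2] := upset_trunc (up nn nU).
exists m, delta, (c1 + c2)%N, e, kap, (fun u => lead jj u /\ ~ lead nn u); split.
- move=> u; have [a1 b1] := tr1 (c1 + c2)%N u (leq_addr _ _).
  have [a2 b2] := tr2 (c1 + c2)%N u (leq_addl _ _).
  by split=> -[? ?]; split; auto.
- move=> u i [lu _] nki [_]; apply; apply: leadU lu => k g Jg.
  rewrite (negbTE nki) addn0; apply: gen_ideal_sub; left; apply: ideal_mulP => //.
  exact: tmax.
- move=> k d [g [hg [Jg nNg]]].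
  (* Without such a monomial, both sets have the same leading monomials in this bidegree, so they
     coincide; cancelling [b] puts [g] in [N k]. *)
  apply: NNPP => none.
  have Jb : ideal_pow I k (g * b) by apply: Jg; apply: IP.
  have [F [bF Fg]] := tsurj k (d + delta)%N _ Jb (homogM hg hb).
  have VF : V jj d k F by split=> //; exists g; rewrite mulrC.
  suff [_ [g' [Ng' _]]] : V nn d k F.
    by rewrite Fg mulrC => /(mulfI nzb) gg'; apply: nNg; rewrite gg'.
  have VZ M : (forall k, is_gideal (M k)) ->
      forall v w z, V M d k v -> V M d k w -> V M d k (v + z *: w).
    move=> idM v w z [bv [gv [Mgv hgv vE]]] [bw [gw [Mgw hgw wE]]]; split.
      by apply: bihomogD => //; apply: bihomogZ.
    exists (gv + z *: gw); split; last by rewrite raddfD /= comp_mpolyZ vE wE mulrDr scalerAr.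
      by have [_ MD _] := idM k; apply: MD => //; apply: gidealZ.
    exact: homogDZ.
  have VNJ v : V nn d k v -> V jj d k v.
    by case=> bv [gv [Ngv hgv vE]]; split=> //; exists gv; split=> //; apply: max_colon_sub.
  apply: (@lead_subspace _ _ (V jj d k) (V nn d k)) VF => [v w z Vv /VNJ Vw||v w z|v Vv nzv].
  - by rewrite -scaleNr; apply: VZ.
  - split; first exact: bihomog0.
    exists 0; split; [by case: (idN k) | exact: homog0 | by rewrite raddf0 mulr0].
  - exact: VZ.
  have [dv kv] := bihomog_mlead nzv (proj1 Vv).
  have [d1 [w [Vw nzw wv]]] : lead nn (mlead v).
    apply: NNPP => nl; apply: none; exists (mlead v); split=> //; split=> //.
    by exists d, v; rewrite /kd kv.
  have [dw kw] := bihomog_mlead nzw (proj1 Vw).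
  exists w; split=> //; move: Vw; rewrite /kd kv.
  suff -> : d1 = d by [].
  by move: dw; rewrite wv dv => /addIn.
move=> k u [[d [F [[bF [g [Jg hg Fg]]] nzF Fu]]] nlead] ku.
exists d; last by have [<- _] := bihomog_mlead nzF bF; rewrite Fu.
rewrite /kd ku in bF Jg; exists g; split=> //; split=> // Ng.
apply: nlead; exists d, F; split=> //; rewrite /kd ku; split=> //.
by exists g.
Qed.

End GenDegrees.
End Rees.

Theorem theorem2p1 (K : fieldType) (n : nat) (I P : subS K n) :
  graded_ideal I -> nonzero_gideal I -> proper_gideal I -> Ass_infty I P ->
  (* (a) *)
  (forall k : nat, (1 <= k)%N -> Ass (ideal_pow I k) P ->
     exists a v w : nat,
       [/\ alpha_is (colon (ideal_pow I k) P) (ideal_pow I k) a,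
           vP_is (ideal_pow I k) P v,
           omega_is (colon (ideal_pow I k) P) (ideal_pow I k) w,
           (a <= v)%N & (v <= w)%N]) /\
  (* (b) *)
  (exists (a b : int) (k0 : nat), forall k : nat, (k0 <= k)%N ->
     exists d : nat, alpha_is (colon (ideal_pow I k) P) (ideal_pow I k) d /\
       d%:Z = a * k%:Z + b) /\
  (exists (a b : int) (k0 : nat), forall k : nat, (k0 <= k)%N ->
     exists d : nat, omega_is (colon (ideal_pow I k) P) (ideal_pow I k) d /\
       d%:Z = a * k%:Z + b) /\
  (* (c) *)
  (exists (a b c e : int) (k0 : nat), forall k : nat, (k0 <= k)%N ->
     exists v : nat, v_is (ideal_pow I k) v /\
       a * k%:Z + b <= v%:Z /\ v%:Z <= c * k%:Z + e).
Proof.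
move=> /graded_idealP grI nzI _ [k0 AssP].
have grP : graded P by apply: Ass_graded (graded_pow k0 grI) (AssP _ (leqnn _)).
(* A power of [f] lies in [I^k] for [k = k0 + 1], hence in [P], which is a colon ideal of [I^k]. *)
have IP f : I f -> P f.
  move=> If; have [[idP P1 prP] [g gP]] := AssP _ (leqnSn k0).
  have fk : ideal_pow I k0.+1 (f ^+ k0.+1).
    elim: k0.+1 => [|k IH]; first exact: gen_ideal_sub.
    by rewrite exprSr; apply: ideal_mulP.
  have : P (f ^+ k0.+1).
    apply/gP; have [idk _] := graded_pow k0.+1 grI; exact: gidealMr.
  elim: k0.+1 => [/P1//|k IH]; rewrite exprS => /prP[]//.
have [m [delta [c [e [kap [D [Dtr Dkap TD DT]]]]]]] := gen_degree_monomials grI nzI grP IP.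
have omegaE k d : omega_is (colon (ideal_pow I k) P) (ideal_pow I k) d <->
    gen_degree (ideal_pow I k) P d /\
    forall d', gen_degree (ideal_pow I k) P d' -> (d' <= d)%N.
  split=> [[ex max]|[ex max]]; split=> //.
    by move=> d' [f [hf [Jf Nf]]]; apply: max hf Jf Nf.
  by move=> d' f hf Jf Nf; apply: max; exists f.
have partA k : Ass (ideal_pow I k) P -> exists a v w : nat,
    [/\ alpha_is (colon (ideal_pow I k) P) (ideal_pow I k) a,
        vP_is (ideal_pow I k) P v,
        omega_is (colon (ideal_pow I k) P) (ideal_pow I k) w,
        (a <= v)%N & (v <= w)%N].
  move=> Ak; have grk := graded_pow k grI.
  have [a [aP Ta]] := alpha_gen_degree grk Ak.
  have [v [vP av [d Td vd]]] := vP_bounds grk Ak.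
  (* For fixed [k] the monomials in [D] have bounded degree, hence so do the generators, and [omega]
     exists. *)
  have [B DB] := trunc_inv_bounded Dtr Dkap e k.
  have [||w wP] := @ex_greatest (gen_degree (ideal_pow I k) P) B.
  - by exists a.
  - move=> d' /TD [u [Du ku du]].
    by apply: leq_trans (DB u Du ku); rewrite du leq_addr.
  exists a, v, w; split=> //; [exact/omegaE | exact: av |].
  by case: wP => _ maxw; apply: leq_trans vd (maxw _ Td).
have Dne : exists k0 : nat, forall k, (k0 <= k)%N ->
    exists2 u, D u & wdeg (fun i => nat_of_bool (kap i)) u = k.
  exists k0 => k /AssP Ak.
  have [d [_ /TD [u [Du ku _]]]] := alpha_gen_degree (graded_pow k grI) Ak.
  by exists u.
have wE (z : int) (v : 'X_{1..m}) : \sum_i z * (e i)%:Z * (v i)%:Z = z * (wdeg e v)%:Z.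
  rewrite /wdeg (big_morph Posz PoszD (erefl 0)) mulr_sumr.
  by apply: eq_bigr => i _; rewrite PoszM mulrA.
have omega_linear : exists (a b : int) (k0 : nat), forall k : nat, (k0 <= k)%N ->
    exists d : nat, omega_is (colon (ideal_pow I k) P) (ideal_pow I k) d /\
      d%:Z = a * k%:Z + b.
  have [a [b [k1 lin]]] := trunc_inv_eventually_linear Dtr Dkap (fun i => 1 * (e i)%:Z) Dne.
  (* Subtracting [delta] undoes the multiplication by [b]. *)
  exists a, (b - delta%:Z), k1 => k /lin [[u [Du ku]]]; rewrite wE mul1r => wu max.
  have [d Td du] := DT k u Du ku; exists d; split; last by rewrite addrA -wu du; lia.
  apply/omegaE; split=> // d' /TD [u' [Du' ku' du']].
  by have := max u' Du' ku'; rewrite wE mul1r -wu du du'; lia.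
split; first by move=> k _; apply: partA.
split.
  (* Negated weights turn the maximum into the least generator degree, which is [alpha]. *)
  have [a [b [k1 lin]]] := trunc_inv_eventually_linear Dtr Dkap (fun i => -1 * (e i)%:Z) Dne.
  exists (- a), (- b - delta%:Z), (k0 + k1)%N => k lek.
  have [|[u [Du ku]]] := lin k; first by lia.
  rewrite wE => wu max; have [d [f [hf [Jf nNf]]] du] := DT k u Du ku.
  exists d; split; last by rewrite mulNr addrA -opprD -wu du; lia.
  have Ak : Ass (ideal_pow I k) P by apply: AssP; lia.
  have [d0 [[_ min0] /TD [u' [Du' ku' du']]]] := alpha_gen_degree (graded_pow k grI) Ak.
  split=> [|d' g hg Jg nIg].
    by exists f; split=> //; split=> // If; apply: nNf; apply: gen_ideal_sub; right.
  apply: leq_trans (min0 d' g hg Jg nIg).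
  by have := max u' Du' ku'; rewrite wE -wu du du'; lia.
split=> //.
have [c' [e' [k1 lin]]] := omega_linear.
(* The lower bound is the zero function, the upper one the linear function giving [omega]. *)
exists 0, 0, c', e', (k0 + k1)%N => k lek.
have Ak : Ass (ideal_pow I k) P by apply: AssP; lia.
have [a [v [w [_ [[f [hf fP]] minv] wP _ vw]]]] := partA k Ak.
have [|w' [wP' <-]] := lin k; first by lia.
have [|v' [exv' minv']] := @ex_least (fun d => exists f, is_homog d f /\
    exists P', Ass (ideal_pow I k) P' /\ same_set (colon_elt (ideal_pow I k) f) P').
  by exists v, f; split=> //; exists P.
exists v'; split; first by split=> // d' g hg gP; apply: minv'; exists g.
have v'v : (v' <= v)%N by apply: minv'; exists f; split=> //; exists P.
have ww' : (w <= w')%N.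
  by have [Tw _] := (omegaE k w).1 wP; have [_] := (omegaE k w').1 wP'; apply.
by rewrite mul0r addr0; lia.
Qed.
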